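(* Let $m\ge1$ be a fixed integer, let $q=2^\ell$, and let $r$ be an integer with $1\le r<q$. The number of $(q-r)^*$-bad monomials $\mathbf X^{\mathbf d}$, $\mathbf d\in\mathbb{Z}_q^m$, over $\mathbb{F}_q[\mathbf X]$ is $$\Theta\left(r^{m-\log\lambda_m}\,q^{\log\lambda_m}\right)\quad\text{as }\ell\to\infty,$$ where the implied constants depend only on $m$ (so $r$ may vary with $q$).
   Context: $\log$ is the logarithm in base two. $\mathbb{Z}_q=\{0,1,\dots,q-1\}$ as a set of integers, $\mathbf X=(X_1,\dots,X_m)$, and $\mathbf X^{\mathbf d}=\prod_{t=1}^mX_t^{d_t}$. For $a,b\in\mathbb{Z}_q$, $q=2^\ell$, with binary expansions $a=\sum_{i=0}^{\ell-1}a^{(i)}2^i$, $b=\sum_{i=0}^{\ell-1}b^{(i)}2^i$, write $a\le_2 b$ if $a^{(i)}\le b^{(i)}$ for all $i$; for vectors, $\mathbf i\le_2\mathbf d$ means $i_t\le_2 d_t$ for every coordinate $t$. $\deg(\mathbf i)$ denotes the (integer) sum of the components of $\mathbf i$. For a non-negative integer $a$, define $a\ (\mathrm{mod}^*\ q)$ to be $0$ if $a=0$, and otherwise the unique $b\in\{1,\dots,q-1\}$ with $a\equiv b\pmod{q-1}$. For a positive integer $d<q$, a monomial $\mathbf X^{\mathbf d}$ with $\mathbf d\in\mathbb{Z}_q^m$ is $d^*$-bad over $\mathbb{F}_q[\mathbf X]$ if there exists $\mathbf i\in\mathbb{Z}_q^m$ with $\mathbf i\le_2\mathbf d$ and $\deg(\mathbf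 i)\ (\mathrm{mod}^*\ q)\in\{d,d+1,\dots,q-1\}$. Here this is used with $d=q-r$. The number $\lambda_m$. Let $A_m$ be the $m\times m$ matrix with rows and columns indexed by $0,1,\dots,m-1$ whose entry in row $j$ and column $0$ is $\binom{m}{\ge 2j+1}$ and whose entry in row $j$ and column $c\ge 1$ is $\binom{m}{2j+1-c}$. Here $\binom{b}{\ge a}$ is the number of subsets with at least $a$ elements of a $b$-element set, and $\binom{b}{a}=0$ if $a<0$ or $a>b$. Then $\lambda_m$ is the largest eigenvalue of $A_m$ ($A_m$ is entrywise non-negative, so this is its spectral radius). *)

(* Defs.v *)
From mathcomp Require Import all_boot all_order all_algebra.
From mathcomp Require Import all_classical all_reals all_analysis.

Set Implicit Arguments.
Unset Strict Implicit.
Unset Printing Implicit Defensive.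

Import Order.TTheory GRing.Theory Num.Theory.

Local Open Scope nat_scope.

Definition bin_digit (a i : nat) : nat := (a %/ 2 ^ i) %% 2.

Definition le2 (l a b : nat) : bool :=
  [forall i : 'I_l, bin_digit a i <= bin_digit b i].

(* Elements of Z_q^m with q = 2 ^ l; a monomial X^d is represented by its
   exponent vector d. *)
Notation expvec m l := {ffun 'I_m -> 'I_(2 ^ l)}.

Definition le2v (m l : nat) (i d : expvec m l) : bool :=
  [forall t : 'I_m, le2 l (i t) (d t)].

Definition degv (m l : nat) (i : expvec m l) : nat := \sum_(t < m) i t.

(* Closed formula for a (mod* q); modstar_spec and modstar_uniq show that it is
   the intended representative. *)
Definition modstar (a q : nat) : nat :=
  if a == 0 then 0 else (a.-1 %% q.-1).+1.

Lemma modstar_spec (a q : nat) : 1 < q -> 0 < a ->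
  1 <= modstar a q <= q.-1 /\ a = modstar a q %[mod q.-1].
Proof.
case: q => [|[|q]] // _; case: a => [|a] // _.
rewrite /modstar /= ltn_mod; split=> //.
by rewrite -[a.+1]addn1 -[(_ %% _).+1]addn1 modnDml.
Qed.

Lemma modstar_uniq (a q b : nat) : 1 < q -> 0 < a ->
  1 <= b <= q.-1 -> a = b %[mod q.-1] -> b = modstar a q.
Proof.
case: q => [|[|q]] // _; case: a => [|a] //; case: b => [|b] //= _ lebq.
rewrite /modstar /= -[a.+1]addn1 -[b.+1]addn1 => /eqP.
by rewrite eqn_modDr => /eqP ->; rewrite modn_small // addn1.
Qed.

Definition star_bad (m l k : nat) (d : expvec m l) : bool :=
  [exists i : expvec m l,
    le2v i d && (k <= modstar (degv i) (2 ^ l) <= (2 ^ l).-1)].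

Definition num_star_bad (m l k : nat) : nat :=
  #|[set d : expvec m l | star_bad k d]|.

Definition bin_ge (b a : nat) : nat := #|[set S : {set 'I_b} | a <= #|S|]|.

(* 'C(b, a - c) with integer subtraction: it vanishes when a < c, where the
   truncated difference would give 'C(b, 0) = 1. *)
Definition bin_sub (b a c : nat) : nat := if c <= a then 'C(b, a - c) else 0.

Local Open Scope ring_scope.

Definition Amx (R : realType) (m : nat) : 'M[R]_m :=
  \matrix_(j < m, c < m)
    (if c == 0 :> nat then bin_ge m (2 * j + 1)
     else bin_sub m (2 * j + 1) c)%:R.

(* The set of real eigenvalues is finite, so its supremum is its maximum; it is
   nonempty for m >= 1 because the matrix is entrywise nonnegative
   (Perron-Frobenius), the maximum being then the spectral radius. *)
Definition lambda (R : realType) (m : nat) : R :=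
  sup [set x : R | eigenvalue (Amx R m) x]%classic.

Definition log2 (R : realType) (x : R) : R := ln x / ln 2.

(* Main.v *)
(* Write [u b] for the number of exponents [d t] whose binary digit [b] is 1. The
   degrees of the vectors below [d] are the sums [\sum_b w b * 2 ^ b] with
   [w b <= u b]. To reach [2 ^ l - 1] as closely as possible from below, read the
   digits from the top and keep track of the carry [j] still owed by the lower
   positions: it starts at 0 and position [b] sends [j] to [2 j + 1 - u b],
   truncated at 0. The value after the last digit is the distance from
   [2 ^ l - 1] to the nearest reachable degree below it; up to an additive
   constant depending on [m], the monomial is bad when this distance is less
   than [r].

   Summed over all digit columns, one step of this walk is the matrix [A_m] on
   the carries [0, ..., m-1]; a carry [>= m] doubles its distance to [m-1] at
   every step and can no longer be repaid. With [2 ^ p <= r < 2 ^ (p+1)], the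
   lower [p] columns are therefore essentially free, which gives the factor
   [2 ^ (m p)], and the upper [l - p] ones contribute a row sum of
   [A_m ^ (l - p)]. The latter is of exact order [lambda ^ (l - p)]: on
   [0, ..., m-2] the matrix is primitive and Perron-Frobenius applies, and the
   absorbing carry [m-1] has weight 1 < lambda (for m >= 2). *)
Require Import Defs.
From mathcomp Require Import all_boot all_order all_algebra.
From mathcomp Require Import all_classical all_reals all_analysis.
From mathcomp Require Import ring lra zify.

Set Implicit Arguments.
Unset Strict Implicit.
Unset Printing Implicit Defensive.

Import Order.TTheory GRing.Theory Num.Theory.
Import numFieldNormedType.Exports.
Local Open Scope ring_scope.

(** * Perron-Frobenius for a primitive matrix *)

Section PerronFrobenius.
Local Open Scope classical_set_scope.
Variables (R : realType) (n : nat) (M : 'M[R]_n.+1).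

(** The Collatz-Wielandt condition: the Perron root is the largest second component over pairs whose
    vector is nonnegative and nonzero. *)
Definition subinvariant (p : 'rV[R]_n.+1 * R) : Prop :=
  forall j, p.2 * p.1 0 j <= (p.1 *m M) 0 j.

Lemma closed_subinvariant : closed [set p | subinvariant p].
Proof.
have -> : [set p | subinvariant p] =
    \bigcap_(j in [set: 'I_n.+1])
      (fun p => (p.1 *m M) 0 j - p.2 * p.1 0 j) @^-1` [set x | 0 <= x].
  apply/seteqP; split=> p /= hp j; first by move=> _; rewrite /= subr_ge0 hp.
  by rewrite -subr_ge0; exact: hp.
apply: closed_bigI => j _; apply: preimage_closed; last exact: closed_ge.
move=> p _.
have coord i : (fun q : 'rV[R]_n.+1 * R => q.1 0 i) @ p --> p.1 0 i.
  by apply: (@continuous_comp _ _ _ fst (fun x : 'rV[R]_n.+1 => x 0 i));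
      [exact: cvg_fst|exact: coord_continuous].
apply: cvgB; last by apply: cvgM; [exact: cvg_snd|exact: coord].
have -> : (fun q : 'rV[R]_n.+1 * R => (q.1 *m M) 0 j) =
          (fun q => \sum_i q.1 0 i * M i j).
  by apply/funext => q; rewrite mxE.
rewrite mxE; apply: cvg_big => [|i _]; first exact: (@add_continuous R^o).
by apply: cvgM; [exact: coord|exact: cvg_cst].
Qed.

Hypothesis M_ge0 : forall i j, 0 <= M i j.

(** Sum the inequalities over [j]. The bound provides the compactness needed for a maximum. *)
Lemma subinvariant_le (p : 'rV[R]_n.+1 * R) :
  (forall j, 0 <= p.1 0 j) -> 0 < \sum_j p.1 0 j -> subinvariant p ->
  p.2 <= \sum_i \sum_j M i j.
Proof.
move=> p_ge0 p_gt0 hp; rewrite -(ler_pM2r p_gt0) mulr_sumr.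
apply: (le_trans (ler_sum _ (fun j _ => hp j))).
under eq_bigr do rewrite mxE.
rewrite exchange_big mulr_suml; apply: ler_sum => i _ /=.
rewrite -mulr_sumr mulrC; apply: ler_wpM2l; first exact: sumr_ge0.
by rewrite (bigD1 i) //= lerDl sumr_ge0.
Qed.

Lemma exists_max_subinvariant : exists p : 'rV[R]_n.+1 * R,
  [/\ forall j, 0 <= p.1 0 j, p.1 != 0, 0 <= p.2, subinvariant p &
    forall q : 'rV[R]_n.+1 * R, (forall j, 0 <= q.1 0 j) -> q.1 != 0 ->
      subinvariant q -> q.2 <= p.2].
Proof.
have sum_gt0 (x : 'rV[R]_n.+1) : (forall j, 0 <= x 0 j) -> x != 0 ->
    0 < \sum_j x 0 j.
  move=> x_ge0 /rV0Pn[j xj0]; rewrite (bigD1 j) //=.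
  by rewrite ltr_wpDr ?sumr_ge0 // lt_def xj0 x_ge0.
pose C : R := \sum_i \sum_j M i j.
(* A coordinate sum at least 1 is a closed condition that excludes the zero vector; pairs with
   nonnegative second component rescale into [K]. *)
pose K := ([set x : 'rV[R]_n.+1 | forall i, `[0, 1]%classic (x ord0 i)] `*`
          `[0, C]%classic) `&`
   ([set p | subinvariant p] `&` [set p : 'rV[R]_n.+1 * R | 1 <= \sum_j p.1 0 j]).
have cK : compact K.
  apply: compact_closedI; last apply: closedI.
  - apply: compact_setX; last exact: segment_compact.
    apply: (@rV_compact R n.+1 (fun=> `[0, 1]%classic)) => i.
    exact: segment_compact.
  - exact: closed_subinvariant.
  - rewrite (_ : [set p | _] = (fun p : 'rV[R]_n.+1 * R => \sum_j p.1 0 j)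
       @^-1` [set x | 1 <= x]) //.
    apply: preimage_closed; last exact: closed_ge.
    move=> p _; apply: cvg_big => [|i _]; first exact: (@add_continuous R^o).
    by apply: (@continuous_comp _ _ _ fst (fun x : 'rV[R]_n.+1 => x 0 i));
      [exact: cvg_fst|exact: coord_continuous].
have normalize (x : 'rV[R]_n.+1) (a : R) : (forall j, 0 <= x 0 j) -> x != 0 ->
    0 <= a -> subinvariant (x, a) -> K ((\sum_j x 0 j)^-1 *: x, a).
  move=> x_ge0 x_neq0 a_ge0 hx; have s_gt0 := sum_gt0 x x_ge0 x_neq0.
  split; split=> /=.
  - move=> i; rewrite mxE in_itv /= mulr_ge0 ?invr_ge0 ?(ltW s_gt0) //=.
    rewrite mulrC ler_pdivrMr // mul1r (bigD1 i) //= lerDl sumr_ge0 //.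
  - rewrite in_itv /= a_ge0 /=.
    exact: (@subinvariant_le (x, a)).
  - move=> j /=; rewrite -scalemxAl !mxE mulrCA ler_pM2l ?invr_gt0 //.
    by have := hx j; rewrite /= mxE.
  - under eq_bigr do rewrite mxE.
    by rewrite -mulr_sumr mulVf // gt_eqF.
have K0 : K !=set0.
  exists ((\sum_j (const_mx 1 : 'rV[R]_n.+1) 0 j)^-1 *: const_mx 1, 0).
  apply: normalize => //.
  - by move=> j; rewrite mxE.
  - by apply/rV0Pn; exists ord0; rewrite mxE oner_neq0.
  - move=> j; rewrite /= mul0r mxE sumr_ge0 // => i _.
    by rewrite mxE mul1r.
have [p + pmax] : exists2 c, c \in K & forall t, t \in K -> t.2 <= c.2.
  apply: compact_EVT_max => //; apply: continuous_subspaceT => p.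
  exact: cvg_snd.
rewrite inE => -[[/= p1 p2] [hp sp]].
exists p; split => //.
- by move=> j; have := p1 j; rewrite in_itv /= => /andP[].
- apply/negP => /eqP p0; move: sp; rewrite p0 big1 => [|i _]; last by rewrite mxE.
  by rewrite leNgt ltr01.
- by move: p2; rewrite /= in_itv /= => /andP[].
- move=> [x a] /= x_ge0 x_neq0 hx; have [a_ge0|/ltW a_le0] := leP 0 a.
    have /= := pmax ((\sum_j x 0 j)^-1 *: x, a); apply.
    by rewrite inE; exact: normalize.
  by apply: (le_trans a_le0); move: p2; rewrite /= in_itv /= => /andP[].
Qed.

(** At a maximal pair, a nonzero defect [z] would become strictly positive under [M ^+ N], and
    [x *m M ^+ N] would then allow a larger value. So [x] is an eigenvector, and it is positive
    because [x *m M ^+ N] is. *)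
Theorem Perron_Frobenius N : (forall i j, 0 < (M ^+ N) i j) ->
  exists (a : R) (x : 'rV[R]_n.+1),
    (forall j, 0 < x 0 j) /\ x *m M = a *: x.
Proof.
move=> MN_gt0.
have MN_pos (x : 'rV[R]_n.+1) : (forall j, 0 <= x 0 j) -> x != 0 ->
    forall j, 0 < (x *m M ^+ N) 0 j.
  move=> x_ge0 /rV0Pn[i xi0] j; rewrite mxE (bigD1 i) //=.
  rewrite ltr_wpDr ?sumr_ge0 // => [k _|]; first by rewrite mulr_ge0 // ltW.
  by rewrite mulr_gt0 // lt_def xi0 x_ge0.
have [[x a] /= [x_ge0 x_neq0 a_ge0 hx amax]] := exists_max_subinvariant.
have MNC : M *m M ^+ N = M ^+ N *m M by rewrite !mulmxE -exprS exprSr.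
have xM : x *m M = a *: x.
  apply/eqP; rewrite -subr_eq0; apply/negPn/negP => z_neq0.
  set z := x *m M - a *: x in z_neq0.
  have z_ge0 j : 0 <= z 0 j 
    by rewrite mxE [X in _ + X]mxE [X in _ - X]mxE subr_ge0; exact: hx.
  pose y := x *m M ^+ N.
  have y_gt0 : forall j, 0 < y 0 j := MN_pos x x_ge0 x_neq0.
  have zN_gt0 := MN_pos z z_ge0 z_neq0.
  have yM : y *m M = a *: y + z *m M ^+ N.
    by rewrite /y /z mulmxBl -!mulmxA MNC -scalemxAl addrC subrK.
  (* The least ratio is the amount by which [a] can be raised; the default 1 keeps it positive. *)
  pose e := \big[Num.min/1]_j ((z *m M ^+ N) 0 j / y 0 j).
  have e_gt0 : 0 < e.
    apply: (big_ind (fun u => 0 < u)) => // [u v u0 v0|j _].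
      by rewrite lt_min u0 v0.
    by rewrite divr_gt0.
  suff : a + e <= a by rewrite gerDl leNgt e_gt0.
  apply: (amax (y, a + e)) => /=.
  - by move=> j; exact: ltW.
  - by apply/rV0Pn; exists ord0; rewrite gt_eqF.
  - move=> j /=; rewrite yM mulrDl [leRHS]mxE [X in _ <= X + _]mxE lerD2l -ler_pdivlMr //.
    exact: bigmin_le_cond.
exists a, x; split=> // j.
have xMk k : x *m M ^+ k = a ^+ k *: x.
  elim: k => [|k IH]; first by rewrite !expr0 mulmx1 scale1r.
  by rewrite exprSr -mulmxE mulmxA IH -scalemxAl xM scalerA exprSr.
have := MN_pos x x_ge0 x_neq0 j; rewrite xMk mxE lt_def => /andP[+ _].
by rewrite mulf_eq0 => /norP[_ ?]; rewrite lt_def x_ge0 andbT.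
Qed.

End PerronFrobenius.

(** * The transfer operator and its spectrum *)

Section Transfer.
Variables (R : realType) (m : nat).
Implicit Types (v w : nat -> R) (a : R).

(** [S] is the set of coordinates whose digit is 1. Carries are not cut off at [m]; [A_m] describes
    the action on functions vanishing from [m] on. *)
Definition transfer v (j : nat) : R :=
  \sum_(S : {set 'I_m}) v (j.*2.+1 - #|S|)%N.

Lemma le_transfer v w : (forall j, v j <= w j) ->
  forall j, transfer v j <= transfer w j.
Proof. by move=> vw j; apply: ler_sum. Qed.

Lemma le_iter_transfer n v w : (forall j, v j <= w j) ->
  forall j, iter n transfer v j <= iter n transfer w j.
Proof. by move=> vw; elim: n => [//|n IH] j; exact: le_transfer. Qed.

Lemma transferD v w j :
  transfer (fun i => v i + w i) j = transfer v j + transfer w j.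
Proof. exact: big_split. Qed.

Lemma transferZ a v j : transfer (fun i => a * v i) j = a * transfer v j.
Proof. by rewrite /transfer mulr_sumr. Qed.

Lemma iter_transferD n v w j :
  iter n transfer (fun i => v i + w i) j =
  iter n transfer v j + iter n transfer w j.
Proof.
elim: n j => [//|n IH] j; rewrite -transferD /=.
by congr (transfer _ j); apply/funext.
Qed.

Lemma iter_transferZ n a v j :
  iter n transfer (fun i => a * v i) j = a * iter n transfer v j.
Proof.
elim: n j => [//|n IH] j; rewrite -transferZ /=.
by congr (transfer _ j); apply/funext.
Qed.

Lemma iter_transfer_eigen n a v : (forall j, transfer v j = a * v j) ->
  forall j, iter n transfer v j = a ^+ n * v j.
Proof.
move=> av; elim: n => [|n IH] j; first by rewrite expr0 mul1r.
by rewrite iterS (funext IH) transferZ av mulrA exprSr.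
Qed.

(** Truncated subtraction sends every column with at least [2 j + 1] ones to carry 0, whence the
    special column 0 of [A_m]. *)
Lemma AmxE (j c : 'I_m) :
  Amx R m j c = \sum_(S : {set 'I_m}) (j.*2.+1 - #|S| == c)%N%:R.
Proof.
transitivity (#|[set S : {set 'I_m} | (j.*2.+1 - #|S|)%N == c]|%:R : R); last first.
  by rewrite -sum1dep_card natr_sum big_mkcond; apply: eq_bigr => S _; case: eqP.
rewrite mxE mul2n addn1 /bin_ge /Defs.bin_sub; congr _%:R.
case: eqP => c0; first by apply: eq_card => S; rewrite !inE; lia.
case: (leqP c j.*2.+1) => [le_c|lt_c].
  have := card_draws 'I_m (j.*2.+1 - c)%N; rewrite card_ord => <-.
  apply: eq_card => S.
  by rewrite !inE; lia.
by apply/esym/eq_card0 => S; rewrite !inE; lia.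
Qed.

Lemma sum_Amx v (j : 'I_m) : (forall i, (m <= i)%N -> v i = 0) ->
  \sum_c Amx R m j c * v c = transfer v j.
Proof.
move=> v0; under eq_bigr do rewrite AmxE mulr_suml.
rewrite exchange_big; apply: eq_bigr => S _ /=.
have [lt_m|ge_m] := ltnP (j.*2.+1 - #|S|) m; last first.
  rewrite v0 // big1 // => c _; case: eqP => [cE|_]; last by rewrite mul0r.
  by move: ge_m; rewrite cE leqNgt ltn_ord.
rewrite (bigD1 (Ordinal lt_m)) //= eqxx mul1r big1 ?addr0 // => c /eqP cE.
by case: eqP => [eq_c|_]; [case: cE; exact: val_inj|rewrite mul0r].
Qed.

Lemma lambda_eigen a v : (0 < m)%N -> 1 <= a -> 0 < v 0%N ->
  (forall j, (j < m.-1)%N -> 0 < v j) -> (forall j, (m <= j)%N -> v j = 0) ->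
  (forall j, 0 <= v j) -> (forall j, transfer v j = a * v j) ->
  lambda R m = a.
Proof.
move=> m_gt0 a_ge1 v0_gt0 v_gt0 v0 v_ge0 av.
(* Pair the absolute value of a left eigenvector with [v]: this gives [|x| * s <= a * s]. *)
have ub x : eigenvalue (Amx R m) x -> x <= a.
  move=> /eigenvalueP[y yA y_neq0].
  pose s := \sum_c `|y 0 c| * v c.
  have s_ge0 : 0 <= s by apply: sumr_ge0 => c _; rewrite mulr_ge0.
  have [s_gt0|s_le0] := ltP 0 s.
    apply: (le_trans (ler_norm x)); rewrite -(ler_pM2r s_gt0) mulr_sumr.
    have -> : a * s = \sum_j `|y 0 j| * \sum_c Amx R m j c * v c.
      rewrite mulr_sumr; apply: eq_bigr => j _.
      by rewrite (sum_Amx _ v0) av mulrCA.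
    under [leRHS]eq_bigr do rewrite mulr_sumr.
    rewrite exchange_big; apply: ler_sum => c _ /=.
    rewrite mulrA -normrM.
    under eq_bigr do rewrite mulrA.
    rewrite -mulr_suml; apply: ler_wpM2r => //.
    have := congr1 (fun z : 'rV_m => z 0 c) yA; rewrite !mxE => <-.
    apply: (le_trans (ler_norm_sum _ _ _)); apply: ler_sum => j _.
    rewrite normrM [X in _ * X]ger0_norm // AmxE.
    by apply: sumr_ge0.
  have yv0 c : `|y 0 c| * v c = 0.
    apply/eqP; move: s_le0; rewrite le_eqVlt ltNge s_ge0 orbF.
    rewrite psumr_eq0 => [/allP/(_ c)|j _]; last by rewrite mulr_ge0.
    by rewrite mem_index_enum; apply.
  have lt_m1 : (m.-1 < m)%N by rewrite prednK.
  have y0 c : c != Ordinal lt_m1 -> y 0 c = 0.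
    move=> c_neq; have lt_c : (c < m.-1)%N.
      by have := ltn_ord c; move: c_neq; rewrite -val_eqE /=; lia.
    have /eqP := yv0 c; rewrite mulf_eq0 normr_eq0 => /orP[/eqP //|].
    by rewrite gt_eqF // v_gt0.
  have y_neq : y 0 (Ordinal lt_m1) != 0.
    apply: contraNneq y_neq0 => yl; apply/eqP/rowP => c; rewrite [RHS]mxE.
    by have [->//|/y0] := eqVneq c (Ordinal lt_m1).
  have := congr1 (fun z : 'rV_m => z 0 (Ordinal lt_m1)) yA.
  rewrite !mxE (bigD1 (Ordinal lt_m1)) //= big1 ?addr0 => [|c /y0 ->]; last first.
    by rewrite mul0r.
  rewrite AmxE (bigD1 [set: 'I_m]) //= big1 ?addr0 => [|S S_neq].
    rewrite cardsT card_ord mulrC => /(mulIf y_neq) <-.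
    by case: eqP => // _; exact: le_trans a_ge1.
  case: eqP => // eqS; case/negP: S_neq; rewrite eqEcard finset.subsetT cardsT card_ord.
  rewrite /= in eqS *.
  by move: #|S| eqS m_gt0; clear; case: m => // n k; rewrite /= -addnn; lia.
(* [eigenvalue] speaks of left eigenvectors while [v] is a right one, hence the detour through
   singularity of [A_m - a]. *)
have Aa : eigenvalue (Amx R m) a.
  rewrite /eigenvalue /eigenspace kermx_eq0 row_free_unit.
  apply/negP => A_unit; have Av : (Amx R m - a%:M) *m \col_c v c = 0.
    apply/colP => j; rewrite mulmxBl mul_scalar_mx !mxE -av -sum_Amx //.
    by apply/eqP; rewrite subr_eq0; apply/eqP/eq_bigr => c _; rewrite !mxE.
  have /matrixP/(_ (Ordinal m_gt0) 0)/eqP : \col_c v (c : 'I_m) = 0.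
    by rewrite -(mulKmx A_unit (\col_c v c)) Av mulmx0.
  by rewrite !mxE gt_eqF.
apply/le_anti/andP; split.
  by apply: ge_sup; [exists a|move=> x; exact: ub].
by apply: ub_le_sup => //; exists a => x; exact: ub.
Qed.

End Transfer.

Lemma exists_card_set m u : (u <= m)%N -> exists S : {set 'I_m}, #|S| = u.
Proof.
move=> le_um; have : (0 < 'C(#|'I_m|, u))%N by rewrite card_ord bin_gt0.
by rewrite -card_draws card_gt0 => /set0Pn[S]; rewrite inE => /eqP; exists S.
Qed.

(** * The eigenfunction on the primitive block *)

Section Eigenfunction.
Variables (R : realType) (k : nat).
Let m := k.+2.

(* On the states 0, ..., m-2 every state reaches itself and its two neighbours
   in one step, so this block is primitive; the state m-1 is absorbing. *)
Let B : 'M[R]_k.+1 :=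
  \matrix_(i, j) \sum_(S : {set 'I_m}) (j.*2.+1 - #|S| == i)%N%:R.

Let B_ge0 i j : 0 <= B i j.
Proof. by rewrite mxE sumr_ge0. Qed.

Let B_gt0 (i j : 'I_k.+1) : (i <= j.+1)%N -> (j <= i.+1)%N -> 0 < B i j.
Proof.
move=> le_ij le_ji; have := ltn_ord j; have := ltn_ord i => lt_i lt_j.
have [|S cS] := @exists_card_set m (j.*2.+1 - i)%N.
  by rewrite /m; lia.
rewrite mxE (bigD1 S) //= cS subKn; last by lia.
by rewrite eqxx ltr_pwDl // sumr_ge0.
Qed.

(** Induction on [n]: the first step goes to a neighbour [h] of [i] closer to [j]. *)
Let B_exp_gt0 n (i j : 'I_k.+1) :
  (i <= j + n)%N -> (j <= i + n)%N -> 0 < (B ^+ n) i j.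
Proof.
elim: n i j => [|n IH] i j le_ij le_ji.
  by rewrite expr0 mxE (_ : i == j) // -val_eqE /=; lia.
have B_exp_ge0 l : forall i j, 0 <= (B ^+ l) i j.
  elim: l => [|l IHl] i' j'; first by rewrite expr0 mxE.
  by rewrite exprS -mulmxE mxE sumr_ge0 // => h _; rewrite mulr_ge0.
have [h [h1 h2 h3 h4]] : exists h : 'I_k.+1,
    [/\ (i <= h.+1)%N, (h <= i.+1)%N, (h <= j + n)%N & (j <= h + n)%N].
  have := ltn_ord j; have := ltn_ord i => lt_i lt_j.
  have [lt_ij|lt_ji|eq_ij] := ltngtP i j.
  - have lt_h : (i.+1 < k.+1)%N by lia.
    by exists (Ordinal lt_h); split=> /=; lia.
  - have lt_h : (i.-1 < k.+1)%N by lia.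
    by exists (Ordinal lt_h); split=> /=; lia.
  - by exists i; split; lia.
rewrite exprS -mulmxE mxE (bigD1 h) //= ltr_pwDl //.
  by rewrite mulr_gt0 // ?B_gt0 ?IH.
by rewrite sumr_ge0 // => l _; rewrite mulr_ge0.
Qed.

(** The Perron vector is extended by 0: from a carry at least [m-1] one never gets below [m-1], so
    the equation persists there. *)
Lemma exists_eigenfunction : exists (a : R) (v : nat -> R),
  [/\ 1 < a, forall j, (j < k.+1)%N -> 0 < v j,
      forall j, (k.+1 <= j)%N -> v j = 0 &
      forall j, transfer m v j = a * v j].
Proof.
have [|a [x [x_gt0 xB]]] := Perron_Frobenius B_ge0 (N := k).
  by move=> i j; apply: B_exp_gt0; have := ltn_ord i; have := ltn_ord j; lia.
pose v j := if (j < k.+1)%N then x 0 (inord j) else 0.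
have v_gt0 j : (j < k.+1)%N -> 0 < v j by rewrite /v => ->.
have v0 j : (k.+1 <= j)%N -> v j = 0 by move=> ge_j; rewrite /v ltnNge ge_j.
have v_ge0 j : 0 <= v j.
  by have [/v_gt0/ltW|/v0 ->] := ltnP j k.+1.
have av j : transfer m v j = a * v j.
  have [lt_j|ge_j] := ltnP j k.+1; last first.
    rewrite v0 // mulr0 /transfer big1 // => S _; apply: v0.
    by have := max_card S; rewrite card_ord /m; lia.
  have := congr1 (fun z : 'rV_k.+1 => z 0 (inord j)) xB.
  rewrite mxE [RHS]mxE [v j]/v lt_j => <-.
  under [RHS]eq_bigr do rewrite mxE mulr_sumr inordK //.
  rewrite exchange_big /=; apply: eq_bigr => S _.
  have [lt_S|ge_S] := ltnP (j.*2.+1 - #|S|) k.+1; last first.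
    rewrite v0 // big1 // => i _; case: eqP => [iE|_]; last by rewrite mulr0.
    by move: ge_S; rewrite iE leqNgt ltn_ord.
  rewrite (bigD1 (Ordinal lt_S)) //= eqxx mulr1 big1 ?addr0 => [|i /eqP i_neq].
    by rewrite /v lt_S; congr (x 0 _); apply: val_inj; rewrite /= inordK.
  case: eqP => [iE|_]; last by rewrite mulr0.
  by case: i_neq; apply: val_inj.
exists a, v; split=> //.
have v0_gt0 := v_gt0 0%N (ltn0Sn k).
(* From carry 0, both the full column and a one-element column lead back to 0, so [a >= 2]. *)
rewrite -(ltr_pM2r v0_gt0) mul1r -av /transfer.
rewrite (bigD1 [set: 'I_m]) //= (bigD1 [set ord0]) /=; last first.
  by rewrite eqEcard finset.subsetT cardsT card_ord cards1.
rewrite cardsT card_ord cards1 subn1 /= ltrDl ltr_wpDr // sumr_ge0 //.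
Qed.

End Eigenfunction.

(** * Exact exponential growth of the iterates *)

Section Growth.
Variables (R : realType).

Lemma transfer1E (v : nat -> R) j : transfer 1 v j = v j.*2.+1 + v j.*2.
Proof.
rewrite /transfer (bigD1 finset.set0) //= cards0 subn0; congr (_ + _).
rewrite (bigD1 [set: 'I_1]) /=; last by rewrite -card_gt0 cardsT card_ord.
rewrite cardsT card_ord subn1 /= big1 ?addr0 // => S /andP[S0 ST].
have := max_card S; rewrite card_ord; move: S0 ST.
rewrite -card_gt0 eqEcard finset.subsetT cardsT card_ord /=; lia.
Qed.

Lemma iter_transfer_growth m : (0 < m)%N ->
  1 <= lambda R m /\ exists c C : R, [/\ 0 < c, 0 < C &
    forall n, c * lambda R m ^+ n <=
        iter n (transfer m) (fun j => (j <= 0)%N%:R) 0 /\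
      iter n (transfer m) (fun j => (j < m)%N%:R) 0 <= C * lambda R m ^+ n].
Proof.
case: m => [//|[|k]] _.
  (* For [m = 1] the primitive block is empty; carry 0 is absorbing and gives eigenvalue 1. *)
  pose v j : R := (j < 1)%N%:R.
  have v1 j : transfer 1 v j = 1 * v j.
    by rewrite transfer1E /v mul1r; case: j => [|j] //=; rewrite ?add0r ?addr0.
  have -> : lambda R 1 = 1 by apply: (@lambda_eigen _ _ _ v) => //; case.
  split=> //; exists 1, 1; split=> // n.
  by rewrite (iter_transfer_eigen _ v1) expr1n !mul1r.
have [a [v [a_gt1 v_gt0 v0 av]]] := exists_eigenfunction R k.
set m := k.+2 in av *.
have v_ge0 j : 0 <= v j by have [/v_gt0/ltW|/v0 ->] := ltnP j k.+1.
have -> : lambda R m = a.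
  apply: (lambda_eigen _ _ _ _ _ _ av) => //; [exact: ltW|exact: v_gt0|].
  by move=> j /ltnW; exact: v0.
have a_gt0 : 0 < a := lt_trans ltr01 a_gt1.
split; first exact: ltW.
have [M M_gt0 vM] : exists2 M, 0 < M & forall j, v j <= M.
  exists (1 + \sum_(i < k.+1) v i) => [|j]; first by rewrite ltr_pwDl ?sumr_ge0.
  have [lt_j|/v0 ->] := ltnP j k.+1; last by rewrite addr_ge0 ?sumr_ge0.
  rewrite (bigD1 (Ordinal lt_j)) //= addrCA lerDl addr_ge0 // sumr_ge0 //.
have [e e_gt0 ve] : exists2 e, 0 < e & forall j, (j < k.+1)%N -> e <= v j.
  exists (\big[Num.min/1]_(i < k.+1) v i) => [|j lt_j].
    by apply: (big_ind (fun u => 0 < u)) => // [x y x0 y0|i _];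
      rewrite ?lt_min ?x0 ?y0 ?v_gt0.
  exact: (bigmin_le_cond _ (j := Ordinal lt_j)).
pose d0 j : R := (j <= 0)%N%:R.
pose d j : R := (j == k.+1)%:R.
have d0_ge0 n j : 0 <= iter n (transfer m) d0 j.
  elim: n j => [|n IH] j; first exact: ler0n.
  by apply: sumr_ge0 => S _; exact: IH.
(* The full column strictly decreases a carry in [1, ..., m-2] and fixes 0. *)
have d0_ge1 n j : (j <= n)%N -> (j < k.+1)%N -> 1 <= iter n (transfer m) d0 j.
  elim: n j => [|n IH] j le_jn lt_jk; first by rewrite /= /d0 le_jn.
  rewrite iterS /transfer (bigD1 [set: 'I_m]) //= ler_wpDr ?sumr_ge0 //.
  by rewrite cardsT card_ord IH /m; lia.
(* The carry [m-1] returns to itself only through the full column; inflow from smaller carries is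
   absorbed by a multiple of [v]. *)
have d_le j : transfer m d j <= d j + #|{set 'I_m}|%:R / e * v j.
  have L_ge0 : 0 <= #|{set 'I_m}|%:R / e * v j.
    by rewrite mulr_ge0 // divr_ge0 // ltW.
  have [lt_j|gt_j|->] := ltngtP j k.+1.
  - apply: (@le_trans _ _ #|{set 'I_m}|%:R).
      rewrite -sum1_card natr_sum; apply: ler_sum => S _.
      by rewrite /d; case: (_ == _).
    rewrite /d ltn_eqF // add0r mulrAC ler_pdivlMr //.
    by apply: ler_wpM2l => //; exact: ve.
  - rewrite /transfer big1 => [|S _]; first by rewrite addr_ge0 ?ler0n.
    by rewrite /d; case: eqP => //; have := max_card S; rewrite card_ord /m; lia.
  - rewrite [v _]v0 // mulr0 addr0 /d eqxx /transfer (bigD1 [set: 'I_m]) //=.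
    rewrite big1 => [|S S_neq]; first by rewrite addr0; case: (_ == _).
    case: eqP => // S_eq; case/negP: S_neq.
    rewrite eqEcard finset.subsetT cardsT card_ord /=.
    by move: S_eq; rewrite /m; lia.
(* Summing these inflows gives a geometric series of ratio [a > 1], hence the denominator
   [a - 1]. *)
pose L := #|{set 'I_m}|%:R / e / (a - 1).
have L_ge0 : 0 <= L by rewrite !divr_ge0 ?subr_ge0 // ltW.
have dn_le n j : iter n (transfer m) d j <= d j + L * (a ^+ n - 1) * v j.
  elim: n j => [|n IH] j; first by rewrite expr0 subrr mulr0 mul0r addr0.
  pose w i := d i + L * (a ^+ n - 1) * v i.
  apply: (@le_trans _ _ (transfer m w j)); first exact: le_transfer.
  rewrite transferD transferZ av.
  apply: (le_trans (lerD (d_le j) (lexx _))); rewrite -addrA lerD2l.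
  have a1 : a - 1 != 0 by rewrite subr_eq0 gt_eqF.
  by rewrite le_eqVlt /L exprS; apply/orP; left; apply/eqP; field; rewrite a1 gt_eqF.
have am_gt0 : 0 < M * a ^+ k by rewrite mulr_gt0 ?exprn_gt0.
(* Lower constant: after [k] steps the indicator of 0 dominates [v / M]. Upper constant: the
   indicator of [j < m] is at most [v / e + d]. *)
exists (v 0%N / (M * a ^+ k)), ((e^-1 + L) * v 0%N); split.
- by rewrite divr_gt0 // v_gt0.
- by rewrite mulr_gt0 ?v_gt0 // ltr_pwDl // invr_gt0.
move=> n; split.
  rewrite mulrAC ler_pdivrMr // [leRHS]mulrC.
  have [le_kn|lt_nk] := leqP k n; last first.
    apply: (@le_trans _ _ (M * a ^+ k * 1)).
      rewrite mulr1; apply: ler_pM => //; first by rewrite exprn_ge0 // ltW.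
      by apply: ler_weXn2l; [exact: ltW|exact: ltnW].
    by rewrite ler_wpM2l ?d0_ge1 // ltW.
  have -> : v 0%N * a ^+ n = a ^+ k * (a ^+ (n - k) * v 0%N).
    by rewrite -[in LHS](subnK le_kn) exprD; ring.
  rewrite [M * _]mulrC -mulrA ler_pM2l ?exprn_gt0 //.
  rewrite -[in leRHS](subnK le_kn) iterD.
  rewrite -iter_transferZ -(iter_transfer_eigen _ av).
  apply: le_iter_transfer => j.
  have [lt_j|/v0 ->] := ltnP j k.+1; last by rewrite mulr_ge0 // ltW.
  by apply: (le_trans (vM j)); rewrite -{1}[M]mulr1 ler_wpM2l ?d0_ge1 // ltW.
apply: (@le_trans _ _ (iter n (transfer m) (fun j => e^-1 * v j + d j) 0%N)).
  apply: le_iter_transfer => j; rewrite /d.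
  have [lt_j|gt_j|->] := ltngtP j k.+1.
  - rewrite (leq_trans lt_j) // addr0 mulrC ler_pdivlMr // mul1r; exact: ve.
  - have -> : (j < m)%N = false by apply/negbTE; rewrite -leqNgt.
    by rewrite addr0 mulr_ge0 // invr_ge0 ltW.
  - by rewrite ltnSn lerDr mulr_ge0 // invr_ge0 ltW.
rewrite iter_transferD iter_transferZ (iter_transfer_eigen _ av).
apply: (le_trans (lerD (lexx _) (dn_le n 0%N))).
have -> : d 0%N = 0 by [].
rewrite -subr_ge0; set X := _ - _; have -> : X = L * v 0%N by rewrite /X; ring.
exact: mulr_ge0.
Qed.

End Growth.

(** * Carries and digit columns *)

Section Carries.
Local Open Scope nat_scope.

(* [deficit u l j] is the least [c] such that [c + \sum_(b < l) w b * 2 ^ b]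
   equals [2 ^ l * j.+1 - 1] for some digits [w b <= u b]: carrying out [j] and
   producing a 1 in position [b] requires a carry [j.*2.+1 - w b] from below. *)
Fixpoint deficit (u : nat -> nat) (l j : nat) : nat :=
  if l is l'.+1 then deficit u l' (j.*2.+1 - u l') else j.

Lemma eq_deficit u u' l j : (forall b, b < l -> u b = u' b) ->
  deficit u l j = deficit u' l j.
Proof.
elim: l j => [//|l IH] j uu' /=.
by rewrite uu' // IH // => b lt_b; rewrite uu' // ltnW.
Qed.

Lemma leq_deficit u l j j' : j <= j' -> deficit u l j <= deficit u l j'.
Proof. by elim: l j j' => [//|l IH] j j' le_j; apply: IH; lia. Qed.

Lemma bin_digitDM x e l b : x < 2 ^ l -> e < 2 -> b <= l ->
  bin_digit (x + 2 ^ l * e) b = if b == l then e else bin_digit x b.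
Proof.
move=> lt_x lt_e le_b; rewrite /bin_digit addnC mulnC.
have [->|ne_b] := eqVneq b l.
  by rewrite divnMDl ?expn_gt0 // divn_small // addn0 modn_small.
have -> : e * 2 ^ l = e * 2 ^ (l - b.+1) * 2 * 2 ^ b.
  by rewrite -!mulnA -expnS -expnD; congr (_ * 2 ^ _); lia.
by rewrite divnMDl ?expn_gt0 // modnMDl.
Qed.

Lemma bin_digit_split x l : x < 2 ^ l.+1 ->
  x = x %% 2 ^ l + 2 ^ l * bin_digit x l.
Proof.
move=> lt_x; rewrite /bin_digit [_ %% 2]modn_small.
  by rewrite addnC mulnC -divn_eq.
by rewrite ltn_divLR ?expn_gt0 // -expnS.
Qed.

Lemma bin_digit_modn x l b : x < 2 ^ l.+1 -> b < l ->
  bin_digit (x %% 2 ^ l) b = bin_digit x b.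
Proof.
move=> lt_x lt_b; rewrite [in RHS](bin_digit_split lt_x) bin_digitDM ?ltn_mod //.
- by rewrite ltn_eqF.
- by rewrite expn_gt0.
- exact: ltnW.
Qed.

Variable m : nat.
Implicit Types i d e f : 'I_m -> nat.

Definition digit_sum d b := \sum_t bin_digit (d t) b.

Lemma exists_sum_eq f k : k <= \sum_t f t ->
  exists e, (forall t, e t <= f t) /\ \sum_t e t = k.
Proof.
move=> le_k; rewrite -(subKn le_k); elim: (_ - k) => [|n [e [le_ef sum_e]]].
  by rewrite subn0; exists f.
have [sum0|sum_gt0] := posnP (\sum_t e t).
  by exists e; split=> //; rewrite subnS -sum_e sum0.
have [t e_gt0] : exists t, 0 < e t.
  apply/existsP; apply: contraTT sum_gt0 => /existsPn e0.
  by rewrite -eqn0Ngt sum_nat_eq0; apply/forallP => t; rewrite eqn0Ngt e0.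
exists (fun s => e s - (s == t)); split=> [s|].
  exact: leq_trans (leq_subr _ _) (le_ef s).
rewrite subnS -sum_e [in RHS](bigD1 t) // [in LHS](bigD1 t) //= eqxx subn1.
rewrite (eq_bigr e) => [|s /negbTE->]; last by rewrite subn0.
by case: (e t) e_gt0.
Qed.

(** Induction on the top column: its [w] ones leave the carry [2 j + 1 - w] to the lower digits. The
    bound on the sum forces [w <= 2 j + 1], so nothing is truncated. *)
Lemma deficit_le l i d j : (forall t, i t < 2 ^ l) ->
  (forall t b, b < l -> bin_digit (i t) b <= bin_digit (d t) b) ->
  \sum_t i t < 2 ^ l * j.+1 ->
  \sum_t i t + deficit (digit_sum d) l j < 2 ^ l * j.+1.
Proof.
elim: l i j => [|l IH] i j lt_i le_id lt_sum.
  rewrite big1 => [|t _]; first by rewrite expn0 mul1n add0n ltnSn.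
  by have := lt_i t; case: (i t).
have i_split : \sum_t i t = \sum_t i t %% 2 ^ l + 2 ^ l * digit_sum i l.
  rewrite /digit_sum big_distrr -big_split /=.
  by apply: eq_bigr => t _; exact: bin_digit_split.
have le_w : digit_sum i l <= digit_sum d l by apply: leq_sum => t _; exact: le_id.
have two_gt0 : 0 < 2 ^ l by rewrite expn_gt0.
have lt_w : digit_sum i l < j.+1.*2.
  rewrite -(ltn_pmul2l two_gt0) -mul2n mulnA [2 ^ l * 2]mulnC -expnS.
  by apply: leq_ltn_trans lt_sum; rewrite i_split leq_addl.
have E : 2 ^ l.+1 * j.+1 =
    2 ^ l * (j.*2.+1 - digit_sum i l).+1 + 2 ^ l * digit_sum i l.
  by rewrite expnS -mulnDr [2 * _]mulnC -mulnA; congr (_ * _); lia.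
have := IH (fun t => i t %% 2 ^ l) (j.*2.+1 - digit_sum i l).
rewrite E i_split ltn_add2r in lt_sum.
rewrite E i_split addnAC ltn_add2r => lt_IH.
apply: leq_ltn_trans (lt_IH _ _ lt_sum).
- by rewrite leq_add2l; apply: leq_deficit; lia.
- by move=> t; rewrite ltn_mod.
- by move=> t b lt_b; rewrite bin_digit_modn //; apply: le_id; exact: ltnW.
Qed.

(** Greedy choice: each column, from the top, uses as many ones as are available and needed. *)
Lemma exists_deficit l d j : exists i,
  [/\ forall t, i t < 2 ^ l,
      forall t b, b < l -> bin_digit (i t) b <= bin_digit (d t) b &
      \sum_t i t + (deficit (digit_sum d) l j).+1 = 2 ^ l * j.+1].
Proof.
elim: l j => [|l IH] j.
  by exists (fun=> 0); split=> //; rewrite big1 // expn0 mul1n.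
have [e [le_e sum_e]] := @exists_sum_eq (fun t => bin_digit (d t) l)
  (minn (digit_sum d l) j.*2.+1) (geq_minl _ _).
have [i [lt_i le_i sum_i]] := IH (j.*2.+1 - digit_sum d l).
have e_lt2 t : e t < 2 by apply: leq_ltn_trans (le_e t) _; rewrite ltn_mod.
exists (fun t => i t + 2 ^ l * e t); split.
- move=> t; rewrite expnS mul2n -addnn.
  by have := lt_i t; have := e_lt2 t; case: (e t) => [|[|]] //=; lia.
- move=> t b lt_b; rewrite bin_digitDM //.
  by case: eqP => [->|ne_b]; [exact: le_e|apply: le_i; lia].
rewrite big_split /= -big_distrr /= sum_e addnAC sum_i -mulnDr expnS.
by rewrite [2 * _]mulnC -mulnA; congr (_ * _); lia.
Qed.

End Carries.

(** * Badness in terms of the deficit *)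

Section BadMonomials.
Local Open Scope nat_scope.
Variables m l : nat.
Implicit Type d : expvec m l.

Lemma le2vP (i d : expvec m l) : reflect
  (forall (t : 'I_m) b, b < l -> bin_digit (i t) b <= bin_digit (d t) b)
  (le2v i d).
Proof.
apply: (iffP forallP) => [le_id t b lt_b|le_id t].
  by have /forallP/(_ (Ordinal lt_b)) := le_id t.
by apply/forallP => b; apply: le_id.
Qed.

(** Reducing the degree removes [a < m] multiples of [2 ^ l - 1]. Measured from [2 ^ l * a.+1 - 1],
    the degree misses by at most [a + r - 1], and starting with carry [a] instead of 0 only
    increases the deficit. *)
Lemma star_bad_deficit r d : 0 < r < 2 ^ l -> star_bad (2 ^ l - r) d ->
  deficit (digit_sum (fun t => d t)) l 0 < m + r.-1.
Proof.
move=> /andP[r_gt0 lt_r] /existsP[i /andP[/le2vP le_id /andP[+ _]]].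
rewrite /modstar /degv; case: eqP => [_|s_neq0]; first by lia.
set s := \sum_(t < m) i t in s_neq0 *.
have q1_gt0 : 0 < (2 ^ l).-1 by lia.
have := divn_eq s.-1 (2 ^ l).-1; have := ltn_pmod s.-1 q1_gt0.
set a := _ %/ _; set b := _ %% _ => lt_b sE le_b.
have lt_s : s <= m * (2 ^ l).-1.
  rewrite -[m in m * _]card_ord -sum_nat_const; apply: leq_sum => t _.
  by have := ltn_ord (i t); lia.
have lt_a : a < m.
  by rewrite -(ltn_pmul2r q1_gt0); apply: leq_trans lt_s; lia.
have qa : 2 ^ l * a.+1 = a * (2 ^ l).-1 + a + 2 ^ l.
  by rewrite mulnS -[in 2 ^ l * a](prednK (expn_gt0 2 l)) mulSn; lia.
have lt_sq : s < 2 ^ l * a.+1 by lia.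
have := @deficit_le m l (fun t => i t) (fun t => d t) a _ le_id lt_sq.
have := @leq_deficit (digit_sum (fun t => d t)) l 0 a (leq0n a).
move=> ? /(_ (fun t => ltn_ord (i t))); rewrite -/s; lia.
Qed.

(** The vector attaining the deficit has degree between 1 and [2 ^ l - 1], which the reduction
    leaves unchanged. *)
Lemma deficit_star_bad r d : r < 2 ^ l ->
  deficit (digit_sum (fun t => d t)) l 0 < r -> star_bad (2 ^ l - r) d.
Proof.
move=> lt_r lt_def.
have [i [lt_i le_id]] := @exists_deficit m l (fun t => d t) 0.
rewrite muln1 => sum_i; apply/existsP.
exists [ffun t => Ordinal (lt_i t)]; apply/andP; split.
  by apply/le2vP => t b lt_b; rewrite ffunE; exact: le_id.
have -> : degv [ffun t => Ordinal (lt_i t)] = \sum_t i t.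
  by apply: eq_bigr => t _; rewrite ffunE.
by rewrite /modstar; case: eqP => s_neq0; [|rewrite modn_small]; lia.
Qed.

End BadMonomials.

(** * Splitting off the top digit column *)

Section Counting.
Variables m l : nat.

Lemma join_digit_proof (x : 'I_(2 ^ l)) (b : bool) : (x + 2 ^ l * b < 2 ^ l.+1)%N.
Proof. by have := ltn_ord x; rewrite expnS; case: b; lia. Qed.

Definition join_digit (p : {set 'I_m} * expvec m l) : expvec m l.+1 :=
  [ffun t => Ordinal (join_digit_proof (p.2 t) (t \in p.1))].

Lemma low_digits_proof x : (x %% 2 ^ l < 2 ^ l)%N.
Proof. by rewrite ltn_mod expn_gt0. Qed.

Definition split_digit (d : expvec m l.+1) : {set 'I_m} * expvec m l :=
  ([set t | bin_digit (d t) l == 1%N],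
   [ffun t => Ordinal (low_digits_proof (d t))]).

Lemma split_digitK : cancel split_digit join_digit.
Proof.
move=> d; apply/ffunP => t; rewrite !ffunE; apply: val_inj => /=.
rewrite inE /= [RHS](bin_digit_split (ltn_ord (d t))); congr (_ + _ * _)%N.
by have := ltn_pmod (d t %/ 2 ^ l) (isT : 0 < 2)%N; rewrite -/(bin_digit _ _);
  case: (bin_digit _ _) => [|[|]].
Qed.

Lemma bin_digit_join p t b : (b <= l)%N ->
  bin_digit (join_digit p t) b = if b == l then nat_of_bool (t \in p.1) else bin_digit (p.2 t) b.
Proof.
by move=> le_b; rewrite ffunE /= bin_digitDM //; case: (t \in _).
Qed.

Lemma join_digitK : cancel join_digit split_digit.
Proof.
move=> p; rewrite [RHS]surjective_pairing /split_digit; congr (_, _).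
  by apply/setP => t; rewrite inE bin_digit_join // eqxx; case: (t \in _).
apply/ffunP => t; rewrite !ffunE; apply: val_inj => /=.
by rewrite addnC mulnC modnMDl modn_small.
Qed.

Lemma digit_sum_join p b : (b <= l)%N ->
  digit_sum (fun t => join_digit p t) b =
  if b == l then #|p.1| else digit_sum (fun t => p.2 t) b.
Proof.
move=> le_b; rewrite /digit_sum; under eq_bigr do rewrite bin_digit_join //.
case: ifP => // _; rewrite -sum1_card [RHS]big_mkcond.
by apply: eq_bigr => t _; case: (t \in _).
Qed.

End Counting.

Definition num_deficit_lt m l j x : nat :=
  #|[set d : expvec m l | (deficit (digit_sum (fun t => d t)) l j < x)%N]|.

(** Removing the top column [S] replaces [j] by [2 j + 1 - #|S|]: one transfer step per digit. *)
Lemma num_deficit_ltE (R : realType) m l j x :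
  (num_deficit_lt m l j x)%:R =
  iter l (@transfer R m) (fun i => (i < x)%N%:R) j.
Proof.
have natE l' j' : num_deficit_lt m l' j' x =
    (\sum_(d : expvec m l')
       (deficit (digit_sum (fun t => d t)) l' j' < x))%N.
  by rewrite /num_deficit_lt -sum1dep_card big_mkcond.
elim: l j => [|l IH] j.
  rewrite natE /= sum_nat_const card_ffun card_ord expn0 card_ord exp1n mul1n.
  by [].
rewrite iterS /transfer; under eq_bigr do rewrite -IH.
rewrite -natr_sum; congr _%:R; rewrite natE.
rewrite (reindex (@join_digit m l)) /=; last first.
  by apply: onW_bij; exists (@split_digit m l); [exact: join_digitK|exact: split_digitK].
under [RHS]eq_bigr do rewrite natE.
rewrite pair_bigA /=; apply: eq_bigr => p _.
rewrite digit_sum_join // eqxx; congr (_ (_ < _)%N).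
apply: eq_deficit => b lt_b.
by rewrite digit_sum_join ?(ltnW lt_b) // ltn_eqF.
Qed.

(** * Contribution of the low digit columns *)

Section TransferBounds.
Variables (R : realType) (m : nat).

Lemma transfer_const (a : R) j : transfer m (fun=> a) j = (2 ^ m)%:R * a.
Proof.
rewrite /transfer sumr_const mulr_natl; congr (_ *+ _).
by rewrite -[LHS]cardsT -powersetT card_powerset cardsT card_ord.
Qed.

Lemma iter_transfer_ge0 n (v : nat -> R) : (forall j, 0 <= v j) ->
  forall j, 0 <= iter n (transfer m) v j.
Proof.
move=> v_ge0; elim: n => [|n IH] j; first exact: v_ge0.
by apply: sumr_ge0 => S _; exact: IH.
Qed.

Lemma iter_transfer_lt_le1 p x j :
  iter p (@transfer R m) (fun i => (i < x)%N%:R) j <= (2 ^ m)%:R ^+ p.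
Proof.
elim: p j => [|p IH] j; first by rewrite expr0 /=; case: (_ < _)%N.
by rewrite exprS -(transfer_const _ j); exact: le_transfer.
Qed.

(** The excess [e] over [m-1] at least doubles at each step, even with full columns. *)
Lemma iter_transfer_lt0 p x e j : (m + e <= j.+1)%N -> (x < m + 2 ^ p * e)%N ->
  iter p (@transfer R m) (fun i => (i < x)%N%:R) j = 0.
Proof.
elim: p e j => [|p IH] e j le_j lt_x.
  by rewrite /= ltnNge (_ : (x <= j)%N) //; rewrite expn0 mul1n in lt_x; lia.
rewrite iterS /transfer big1 // => S _; apply: (IH e.*2).
  by have := max_card S; rewrite card_ord; lia.
by move: lt_x; rewrite expnS -mul2n mulnCA mulnA.
Qed.

(** Empty columns are the worst case, and they just double [j.+1]; so every choice of columns
    counts. *)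
Lemma iter_transfer_lt_eq p x j : (2 ^ p * j.+1 <= x)%N ->
  iter p (@transfer R m) (fun i => (i < x)%N%:R) j = (2 ^ m)%:R ^+ p.
Proof.
elim: p j => [|p IH] j; first by rewrite expn0 mul1n /= => ->.
move=> le_x; rewrite exprS -(transfer_const _ j) iterS.
apply: eq_bigr => S _; apply: IH; apply: leq_trans le_x.
by rewrite expnS -mulnA mulnCA leq_pmul2l ?expn_gt0 //; lia.
Qed.

Lemma iter_transfer_lt_le n p r j : (0 < m)%N -> (0 < r <= 2 ^ p)%N ->
  iter (n + p) (@transfer R m) (fun i => (i < m + r.-1)%N%:R) j <=
  (2 ^ m)%:R ^+ p * iter n (transfer m) (fun i => (i < m)%N%:R) j.
Proof.
move=> m_gt0 /andP[r_gt0 le_r]; rewrite iterD -iter_transferZ.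
apply: le_iter_transfer => i; have [lt_i|ge_i] := ltnP i m.
  by rewrite mulr1 iter_transfer_lt_le1.
by rewrite (@iter_transfer_lt0 _ _ 1%N) ?mulr0 //; lia.
Qed.

Lemma iter_transfer_lt_ge n p r j : (2 ^ p <= r)%N ->
  (2 ^ m)%:R ^+ p * iter n (transfer m) (fun i => (i <= 0)%N%:R) j <=
  iter (n + p) (@transfer R m) (fun i => (i < r)%N%:R) j.
Proof.
move=> le_r; rewrite iterD -iter_transferZ.
apply: le_iter_transfer => -[|i].
  by rewrite mulr1 iter_transfer_lt_eq // muln1.
by rewrite mulr0 iter_transfer_ge0.
Qed.

End TransferBounds.

(** * The asymptotic count *)

Lemma powR_log2 (R : realType) (x : R) : 0 < x -> 2 `^ log2 x = x.
Proof.
move=> x_gt0; rewrite /log2 /powR pnatr_eq0 /= divfK ?lnK //.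
by rewrite gt_eqF // ln_gt0 // ltr1n.
Qed.

(** Used to replace [r] by the power of two below it; the absolute value covers exponents of either
    sign. *)
Lemma powR_le_doubling (R : realType) (x y a : R) : 0 < x -> x <= y <= 2 * x ->
  x `^ a <= 2 `^ `|a| * y `^ a /\ y `^ a <= 2 `^ `|a| * x `^ a.
Proof.
move=> x_gt0 /andP[le_xy le_yx].
have [s [s_ge1 s_le2 ->]] : exists s, [/\ 1 <= s, s <= 2 & y = s * x].
  exists (y / x); rewrite ler_pdivlMr // mul1r ler_pdivrMr // divfK //.
  by rewrite gt_eqF.
have s_gt0 : 0 < s by rewrite (lt_le_trans ltr01).
have pow_le b : b <= `|a| -> s `^ b <= 2 `^ `|a|.
  move=> le_b; apply: (le_trans (ler_powR s_ge1 le_b)).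
  by apply: ge0_ler_powR => //; rewrite nnegrE ltW.
have xa_ge0 : 0 <= x `^ a := powR_ge0 x a.
rewrite powRM ?(ltW x_gt0) ?(ltW s_gt0) // mulrA; split; last first.
  by rewrite ler_wpM2r // pow_le // ler_norm.
rewrite -[leLHS]mul1r ler_wpM2r // -ler_pdivrMr ?powR_gt0 // mul1r -powRN.
by apply: pow_le; rewrite -normrN ler_norm.
Qed.

Theorem corollary2 (R : realType) (m : nat) (hm : (1 <= m)%N) :
  exists c C : R,
    [/\ 0 < c, 0 < C &
      exists l0 : nat, forall l r : nat,
        (l0 <= l)%N -> (1 <= r)%N -> (r < 2 ^ l)%N ->
        let bound : R :=
          (r%:R `^ (m%:R - log2 (lambda R m)))
          * ((2 ^ l)%:R `^ log2 (lambda R m)) in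
        c * bound <= (num_star_bad m l (2 ^ l - r))%:R <= C * bound].
Proof.
have [lam_ge1 [c [C [c_gt0 C_gt0 growth]]]] := @iter_transfer_growth R m hm.
have lam_gt0 : 0 < lambda R m := lt_le_trans ltr01 lam_ge1.
move: lam_ge1 lam_gt0 growth; set lam := lambda R m => lam_ge1 lam_gt0 growth.
set E := m%:R - log2 lam.
pose D : R := 2 `^ `|E|.
have D_gt0 : 0 < D by rewrite powR_gt0.
have pow_lam n : ((2 ^ n)%:R : R) `^ log2 lam = lam ^+ n.
  by rewrite natrX -powR_mulrn // -powRrM mulrC powRrM powR_log2 // powR_mulrn // ltW.
(* Since [E + log2 lam = m], the free low columns split into the two factors of the bound. *)
have pow_E n : (2 ^ m)%:R ^+ n = lam ^+ n * ((2 ^ n)%:R : R) `^ E.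
  rewrite -pow_lam -powRD; last by rewrite pnatr_eq0 expn_eq0 implybT.
  by rewrite /E addrC subrK powR_mulrn // -!natrX -!expnM mulnC.
(* [D] pays for rounding [r] to [2 ^ p]; [2 ^ m / lam] pays for freeing [p + 1] columns instead of
   [p] in the upper bound, where [r <= 2 ^ p.+1] is needed. *)
exists (c / D), (C * D * ((2 ^ m)%:R / lam)); split.
- exact: divr_gt0.
- by rewrite !mulr_gt0 ?invr_gt0 // ltr0n expn_gt0.
exists 0%N => l r _ r_gt0 lt_r /=; rewrite pow_lam -/E.
pose p := trunc_log 2 r.
have le_p : (2 ^ p <= r)%N := trunc_logP (isT : 1 < 2)%N r_gt0.
have lt_p : (r < 2 ^ p.+1)%N := trunc_log_ltn r (isT : 1 < 2)%N.
have lt_pl : (p < l)%N by rewrite -(ltn_exp2l _ _ (isT : 1 < 2)%N) (leq_ltn_trans le_p).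
have [le_PR le_RP] : (2 ^ p)%:R `^ E <= D * (r%:R : R) `^ E /\
    (r%:R : R) `^ E <= D * (2 ^ p)%:R `^ E.
  apply: powR_le_doubling; first by rewrite ltr0n expn_gt0.
  by rewrite -natrM -expnS !ler_nat le_p ltnW.
have [growth_ge _] := growth (l - p)%N; have [_ growth_le] := growth (l - p.+1)%N.
apply/andP; split.
  apply: (@le_trans _ _ (num_deficit_lt m l 0 r)%:R); last first.
    rewrite ler_nat; apply/subset_leq_card/fintype.subsetP => d; rewrite !inE.
    exact: deficit_star_bad.
  rewrite num_deficit_ltE -[in leRHS](subnK (ltnW lt_pl)).
  apply: le_trans (iter_transfer_lt_ge R m _ _ le_p).
  have q_ge0 : 0 <= ((2 ^ m)%:R : R) ^+ p by rewrite exprn_ge0.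
  apply: le_trans (ler_wpM2l q_ge0 growth_ge).
  rewrite pow_E.
  have -> : lam ^+ p * (2 ^ p)%:R `^ E * (c * lam ^+ (l - p)) =
            c / D * (D * (2 ^ p)%:R `^ E * lam ^+ l).
    rewrite -[in RHS](subnK (ltnW lt_pl)) exprD; field.
    by rewrite gt_eqF.
  rewrite ler_pM2l ?divr_gt0 // ler_pM2r ?exprn_gt0 //.
apply: (@le_trans _ _ (num_deficit_lt m l 0 (m + r.-1))%:R).
  rewrite ler_nat; apply/subset_leq_card/fintype.subsetP => d; rewrite !inE.
  by apply: star_bad_deficit; rewrite r_gt0.
rewrite num_deficit_ltE -[in leLHS](subnK lt_pl).
have rp : (0 < r <= 2 ^ p.+1)%N by rewrite r_gt0 ltnW.
apply: le_trans (iter_transfer_lt_le R _ _ hm rp) _.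
have q_ge0 : 0 <= ((2 ^ m)%:R : R) ^+ p.+1 by rewrite exprn_ge0.
apply: le_trans (ler_wpM2l q_ge0 growth_le) _.
have -> : (2 ^ m)%:R ^+ p.+1 * (C * lam ^+ (l - p.+1)) =
          C * ((2 ^ m)%:R / lam) * ((2 ^ p)%:R `^ E * lam ^+ l).
  rewrite -[in RHS](subnK lt_pl) exprD !exprS pow_E; field.
  by rewrite gt_eqF.
have -> : C * D * ((2 ^ m)%:R / lam) * (r%:R `^ E * lam ^+ l) =
          C * ((2 ^ m)%:R / lam) * (D * r%:R `^ E * lam ^+ l) by ring.
rewrite ler_pM2l ?ler_pM2r ?exprn_gt0 //.
by rewrite mulr_gt0 // divr_gt0 // ltr0n expn_gt0.
Qed.
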